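(* Let $n\ge2$, $m\ge1$, let $R$ be a dominant region of the $m$-Shi arrangement with $m$-minimal alcove $\mathcal A$, and let $\lambda$ be the $n$-core with $\Phi(\lambda)=\mathcal A$. Then $H_{\theta,m}$ is a separating wall for $R$ if and only if $h^\lambda_{11}=n(m-1)+1$, where $h^\lambda_{11}$ is the hook length of the box $(1,1)$ of $\lambda$.
   Context: Let $e_1,\dots,e_n$ be the standard basis of $\mathbb R^n$ with the standard inner product $\langle\cdot,\cdot\rangle$, and $V=\{(a_1,\dots,a_n)\in\mathbb R^n:\sum_i a_i=0\}$. For $1\le i\le j\le n-1$ let $\alpha_{ij}=e_i-e_{j+1}$, $\alpha_i=\alpha_{ii}$, $\Delta^+=\{\alpha_{ij}\}$, $\theta=\alpha_{1,n-1}$. For $\alpha\in\Delta^+$, $k\in\mathbb Z$, let $H_{\alpha,k}=\{v\in V:\langle v,\alpha\rangle=k\}$. The $m$-Shi arrangement is $\{H_{\alpha,k}:\alpha\in\Delta^+,\,-m<k\le m\}$; its regions are the connected components of the complement of the union of its hyperplanes, and a region is dominant if it lies in $\{v\in V:\langle v,\alpha_i\rangle\ge0\ \forall i\}$. Alcoves are the connected components of $V\setminus\bigcup_{\alpha\in\Delta^+,k\in\mathbb Z}H_{\alpha,k}$; the fundamental alcove $A_0$ is the interior of $\{v\in V:\langle v,\theta\rangle\le1,\ \langle v,\alpha_i\rangle\ge0\ \forall i\}$. Each region contains a unique alcove separated from $A_0$ by the fewest hyperplanes $H_{\alpha,k}$ ($k\in\mathbb Z$), its $m$-minimal alcove. A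 wall of a region $R$ is a hyperplane of the $m$-Shi arrangement supporting a facet of $R$; it is a separating wall if $R$ and $A_0$ lie in different closed half-spaces determined by it. The affine symmetric group $\widehat{\mathfrak S}_n$ is the Coxeter group generated by $s_0,\dots,s_{n-1}$ (with $s_i^2=1$, $s_is_j=s_js_i$ if $i\not\equiv j\pm1\bmod n$, $s_is_js_i=s_js_is_j$ if $i\equiv j\pm1\bmod n$, for $n>2$; free product of two order-2 groups for $n=2$); $\mathfrak S_n=\langle s_1,\dots,s_{n-1}\rangle$. It acts freely and transitively on alcoves via its action on $V$: $s_i$ swaps coordinates $i,i+1$ ($i\ne0$) and $s_0(a_1,\dots,a_n)=(a_n+1,a_2,\dots,a_{n-1},a_1-1)$. It acts on $n$-cores (partitions with no hook length divisible by $n$): a box $(i,j)$ has residue $j-i\bmod n$; $s_r\lambda$ adds all addable boxes of residue $r$ if any exist, otherwise removes all removable boxes of residue $r$ if any exist, otherwise fixes $\lambda$. The map $\Phi$ sends $w\emptyset$ to $w^{-1}A_0$, where $w$ is of minimal length in its coset $w\mathfrak S_n$; $\Phi$ is a bijection from $n$-cores onto dominant alcoves. *)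

(* Defs.v *)
From HB Require Import structures.
From mathcomp Require Import all_boot all_order all_algebra.
From mathcomp Require Import perm.
From mathcomp Require Import boolp classical_sets cardinality reals.
From mathcomp Require Import topology normedtype.

Set Implicit Arguments.
Unset Strict Implicit.
Unset Printing Implicit Defensive.

Import Order.TTheory GRing.Theory Num.Theory.
Import numFieldNormedType.Exports.

Local Open Scope classical_set_scope.
Local Open Scope card_scope.
Local Open Scope ring_scope.

(** * Roots and hyperplanes *)

Definition dot (R : realType) (n : nat) (u v : 'rV[R]_n) : R :=
  \sum_i u ord0 i * v ord0 i.

(* Indices of basis vectors and roots are 1-based: [basis_vec R n k] is e_k for
   1 <= k <= n. *)
Definition basis_vec (R : realType) (n k : nat) : 'rV[R]_n :=
  \row_(j < n) (j.+1 == k)%:R.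

Definition V (R : realType) (n : nat) : set 'rV[R]_n :=
  [set v | \sum_i v ord0 i = 0].

Definition alpha (R : realType) (n i j : nat) : 'rV[R]_n :=
  basis_vec R n i - basis_vec R n j.+1.

Definition simple_root (R : realType) (n i : nat) : 'rV[R]_n := alpha R n i i.

Definition theta (R : realType) (n : nat) : 'rV[R]_n := alpha R n 1 n.-1.

Definition pos_roots (R : realType) (n : nat) : set 'rV[R]_n :=
  [set a | exists i j : nat,
     [/\ (1 <= i)%N, (i <= j)%N, (j <= n.-1)%N & a = alpha R n i j]].

Definition hyperplane (R : realType) (n : nat) (a : 'rV[R]_n) (k : int) :
    set 'rV[R]_n :=
  [set v | V v /\ dot v a = k%:~R].

Definition ge_halfspace (R : realType) (n : nat) (a : 'rV[R]_n) (k : int) :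
    set 'rV[R]_n :=
  [set v | V v /\ k%:~R <= dot v a].

Definition le_halfspace (R : realType) (n : nat) (a : 'rV[R]_n) (k : int) :
    set 'rV[R]_n :=
  [set v | V v /\ dot v a <= k%:~R].

Definition in_different_halfspaces (R : realType) (n : nat)
    (a : 'rV[R]_n) (k : int) (X Y : set 'rV[R]_n) : Prop :=
  (X `<=` ge_halfspace a k /\ Y `<=` le_halfspace a k) \/
  (X `<=` le_halfspace a k /\ Y `<=` ge_halfspace a k).

(** * Regions and alcoves *)

Definition affine_arrangement (R : realType) (n : nat) :
    set (set 'rV[R]_n) :=
  [set H | exists a k, pos_roots a /\ H = hyperplane a k].

Definition shi_arrangement (R : realType) (n m : nat) :
    set (set 'rV[R]_n) :=
  [set H | exists a (k : int),
     [/\ pos_roots a, - m%:Z < k <= m%:Z & H = hyperplane a k]].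

Definition complement (R : realType) (n : nat) (Arr : set (set 'rV[R]_n)) :
    set 'rV[R]_n :=
  @V R n `\` \bigcup_(H in Arr) H.

Definition components (T : topologicalType) (X : set T) : set (set T) :=
  [set C | exists2 x, X x & C = connected_component X x].

Definition shi_region (R : realType) (n m : nat) (Reg : set 'rV[R]_n) : Prop :=
  components (complement (@shi_arrangement R n m)) Reg.

Definition alcove (R : realType) (n : nat) (A : set 'rV[R]_n) : Prop :=
  components (complement (@affine_arrangement R n)) A.

Definition dominant_chamber (R : realType) (n : nat) : set 'rV[R]_n :=
  [set v | V v /\
     forall i : nat, (1 <= i <= n.-1)%N -> 0 <= dot v (simple_root R n i)].

Definition dominant (R : realType) (n : nat) (X : set 'rV[R]_n) : Prop :=
  X `<=` @dominant_chamber R n.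

(* Interior of X as a subset of V: V has empty interior in 'rV[R]_n. *)
Definition interior_in_V (R : realType) (n : nat) (X : set 'rV[R]_n) :
    set 'rV[R]_n :=
  [set v | V v /\ within (@V R n) (nbhs v) X].

Definition fundamental_alcove (R : realType) (n : nat) : set 'rV[R]_n :=
  interior_in_V
    [set v | dominant_chamber v /\ dot v (theta R n) <= 1].

Definition separating_hyperplanes (R : realType) (n : nat)
    (A B : set 'rV[R]_n) : set (set 'rV[R]_n) :=
  [set H | exists a k,
     [/\ pos_roots a, H = hyperplane a k & in_different_halfspaces a k A B]].

(* Only finitely many hyperplanes separate two alcoves, so comparing
   cardinalities with [#<=] compares their numbers. *)
Definition minimal_alcove (R : realType) (n : nat) (Reg A : set 'rV[R]_n) :
    Prop :=
  [/\ alcove A, A `<=` Reg &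
      forall B, alcove B -> B `<=` Reg ->
        separating_hyperplanes A (@fundamental_alcove R n) #<=
        separating_hyperplanes B (@fundamental_alcove R n)].

(** * Walls *)

Definition affine_hull (R : realType) (n : nat) (X : set 'rV[R]_n) :
    set 'rV[R]_n :=
  [set v | exists (k : nat) (p : 'I_k -> 'rV[R]_n) (c : 'I_k -> R),
     [/\ forall i, X (p i), \sum_i c i = 1 & v = \sum_i c i *: p i]].

(* The face of the closed polyhedron [closure Reg] cut out by a supporting
   hyperplane H is [closure Reg `&` H]; it is a facet, i.e. has the dimension
   of H, iff it affinely spans H. *)
Definition supports_facet (R : realType) (n : nat) (Reg : set 'rV[R]_n)
    (a : 'rV[R]_n) (k : int) : Prop :=
  (Reg `<=` ge_halfspace a k \/ Reg `<=` le_halfspace a k) /\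
  affine_hull (closure Reg `&` hyperplane a k) = hyperplane a k.

Definition wall (R : realType) (n m : nat) (Reg : set 'rV[R]_n)
    (a : 'rV[R]_n) (k : int) : Prop :=
  @shi_arrangement R n m (hyperplane a k) /\ supports_facet Reg a k.

Definition separating_wall (R : realType) (n m : nat) (Reg : set 'rV[R]_n)
    (a : 'rV[R]_n) (k : int) : Prop :=
  wall m Reg a k /\
  in_different_halfspaces a k Reg (@fundamental_alcove R n).

(** * The affine symmetric group *)

(* A word [:: i1; ...; ik] stands for s_{i1} ... s_{ik}. The affine symmetric
   group is the monoid of words modulo the congruence [cox_eq]; the inverse of
   the class of w is the class of [rev w]. *)
Definition cox_adj (n : nat) (i j : 'I_n) : bool :=
  (i == j.+1 %[mod n])%N || (j == i.+1 %[mod n])%N.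

Inductive cox_eq (n : nat) : seq 'I_n -> seq 'I_n -> Prop :=
| cox_refl w : cox_eq w w
| cox_sym u w : cox_eq u w -> cox_eq w u
| cox_trans u v w : cox_eq u v -> cox_eq v w -> cox_eq u w
| cox_cat u u' w w' : cox_eq u u' -> cox_eq w w' -> cox_eq (u ++ w) (u' ++ w')
| cox_invol i : cox_eq [:: i; i] [::]
| cox_comm i j : (2 < n)%N -> ~~ cox_adj i j -> cox_eq [:: i; j] [:: j; i]
| cox_braid i j : (2 < n)%N -> cox_adj i j ->
    cox_eq [:: i; j; i] [:: j; i; j].

Lemma cox_length_subproof (n : nat) (w : seq 'I_n) :
  exists l : nat, `[< exists2 u, cox_eq u w & size u = l >].
Proof. by exists (size w); apply/asboolP; exists w => //; exact: cox_refl. Qed.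

Definition cox_length (n : nat) (w : seq 'I_n) : nat :=
  ex_minn (cox_length_subproof w).

Definition min_coset_rep (n : nat) (w : seq 'I_n) : Prop :=
  forall v : seq 'I_n, all (fun i : 'I_n => (i != 0 :> nat)%N) v ->
    (cox_length w <= cox_length (w ++ v))%N.

(* Coordinates are 0-based here, so for i <> 0 the generator s_i exchanges
   positions i-1 and i; for i = 0, [ord_pred i] is the last position n-1. *)
Definition gen_act (R : realType) (n : nat) (i : 'I_n) (v : 'rV[R]_n) :
    'rV[R]_n :=
  if (i == 0 :> nat)%N then
    \row_j (if j == i then v ord0 (ord_pred i) + 1
            else if j == ord_pred i then v ord0 i - 1
            else v ord0 j)
  else \row_j v ord0 (tperm (ord_pred i) i j).

Definition word_act (R : realType) (n : nat) (w : seq 'I_n) (v : 'rV[R]_n) :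
    'rV[R]_n :=
  foldr (@gen_act R n) v w.

(** * Partitions and cores *)

Definition is_partition (la : seq nat) : bool :=
  sorted geq la && all (fun p => 0 < p)%N la.

Definition in_diagram (la : seq nat) (i j : nat) : bool :=
  (j < nth 0 la i)%N.

Definition arm (la : seq nat) (i j : nat) : nat := (nth 0 la i - j.+1)%N.

Definition leg (la : seq nat) (i j : nat) : nat :=
  (count (fun p => j < p)%N la - i.+1)%N.

(* Boxes are 0-based. The value 0 outside the diagram is a convention, which is
   only met at the corner box of the empty partition. *)
Definition hook_length (la : seq nat) (i j : nat) : nat :=
  if in_diagram la i j then (arm la i j + leg la i j).+1 else 0%N.

Definition is_core (n : nat) (la : seq nat) : Prop :=
  is_partition la /\
  forall i j, in_diagram la i j -> ~~ (n %| hook_length la i j)%N.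

Definition has_residue (n r i j : nat) : bool :=
  (j%:Z - i%:Z == r%:Z %[mod n%:Z])%Z.

(* At most one box can be added to (removed from) a given row i, namely the box
   in column [nth 0 la i] (resp. [(nth 0 la i).-1]). *)
Definition addable (n r : nat) (la : seq nat) (i : nat) : bool :=
  is_partition (incr_nth la i) && has_residue n r i (nth 0%N la i).

Definition removable (n r : nat) (la : seq nat) (i : nat) : bool :=
  [&& (i < size la)%N, sorted geq (set_nth 0%N la i (nth 0%N la i).-1)
    & has_residue n r i (nth 0%N la i).-1].

Definition strip0 (s : seq nat) : seq nat := [seq p <- s | (0 < p)%N].

(* When no box is removable either, the last branch returns la itself. *)
Definition core_gen_act (n : nat) (r : 'I_n) (la : seq nat) : seq nat :=
  if has (addable n r la) (iota 0 (size la).+1) then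
    strip0 [seq (nth 0 la i + addable n r la i)%N | i <- iota 0 (size la).+1]
  else
    strip0 [seq (nth 0 la i - removable n r la i)%N | i <- iota 0 (size la)].

Definition core_act (n : nat) (w : seq 'I_n) (la : seq nat) : seq nat :=
  foldr (@core_gen_act n) la w.

(* The graph of the bijection from n-cores to dominant alcoves. *)
Definition Phi (R : realType) (n : nat) (la : seq nat) (A : set 'rV[R]_n) :
    Prop :=
  exists w : seq 'I_n,
    [/\ min_coset_rep w, la = core_act w [::]
      & A = [set word_act (rev w) v | v in @fundamental_alcove R n]].

(* Main.v *)
Require Import Defs.
From mathcomp Require Import all_boot all_order all_algebra.
From mathcomp Require Import perm.
From mathcomp Require Import boolp classical_sets cardinality reals.
From mathcomp Require Import topology normedtype.
From mathcomp Require Import zify ring lra.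

Set Implicit Arguments.
Unset Strict Implicit.
Unset Printing Implicit Defensive.

Import Order.TTheory GRing.Theory Num.Theory.
Import numFieldNormedType.Exports.

Local Open Scope classical_set_scope.
Local Open Scope ring_scope.

(** Let w act on the integers as an affine permutation f. The beta-set of the
    core w.empty is f(Z_{<=0}), and the center p of the alcove w^-1 A_0 has
    coordinates c - f(j) / n. Dominance makes f increasing on [1, n], so that
    h_11 = f(n) - n - f(1), and the hook condition becomes
    f(n) - f(1) = m n + 1, i.e. <p, theta> = m + 1/n.

    If it holds, the projection of p to H_{theta,m} lies strictly on the same
    side as p of every other hyperplane of the arrangement, because the levels
    of p are multiples of 1/n and theta / (2 n) shifts them by at most 1/(2 n);
    hence it is a point in the relative interior of a facet.
    Conversely, if H_{theta,m} is a separating wall but <p, theta> > m + 1/n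
    and n >= 3, then some index 1 < i < n and some k + l = m satisfy
    <p, e_1 - e_i> >= k and <p, e_i - e_n> >= l. Both bounds are Shi
    conditions, so they hold on the region, and the facet is squeezed into
    {<v, e_1 - e_i> = k}, which does not contain H_{theta,m}. For n = 2 the
    region beyond H_{theta,m} contains infinitely many alcoves, and the
    minimality of the alcove gives the result by counting hyperplanes. *)

(** * Affine permutations of the integers *)

Definition quasiperiodic (n : nat) (f : int -> int) : Prop :=
  forall x t, f (x + t * n%:Z) = f x + t * n%:Z.

Definition affine_permutation (n : nat) (f : int -> int) : Prop :=
  quasiperiodic n f /\ bijective f.

Definition window_increasing (n : nat) (f : int -> int) : Prop :=
  forall i j : nat, (1 <= i <= j)%N -> (j <= n)%N -> f i%:Z <= f j%:Z.

Lemma exists_window_shift (n : nat) (x : int) : (0 < n)%N ->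
  exists (i : nat) (t : int), (1 <= i <= n)%N /\ x = i%:Z + t * n%:Z.
Proof.
move=> n_gt0; exists `|((x - 1) %% n%:Z)%Z|.+1, ((x - 1) %/ n%:Z)%Z.
have := @modz_ge0 (x - 1) n%:Z; have := divz_eq (x - 1) n%:Z.
by split; lia.
Qed.

Lemma affine_permutation_dvdz (n : nat) (f : int -> int) (x y : int) :
  affine_permutation n f -> (n%:Z %| f x - f y)%Z = (n%:Z %| x - y)%Z.
Proof.
move=> [fD /bij_inj f_inj]; apply/dvdzP/dvdzP => -[t e]; exists t.
  have -> : x = y + t * n%:Z by apply: f_inj; rewrite fD; lia.
  by ring.
have -> : x = y + t * n%:Z by lia.
by rewrite fD; ring.
Qed.

Section WindowIncreasing.
Variables (n : nat) (f : int -> int).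
Hypotheses (n_gt0 : (0 < n)%N) (fD : quasiperiodic n f).
Hypothesis f_incr : window_increasing n f.

Lemma quasiperiodic0 : f 0 = f n%:Z - n%:Z.
Proof. by have := fD 0 1; rewrite mul1r add0r => ->; ring. Qed.

Lemma window_increasing_le0 (x : int) : x <= 0 -> f x <= f 0.
Proof.
have [i [t [i_window ->]]] := exists_window_shift x n_gt0 => x_le0.
rewrite fD quasiperiodic0.
have : f i%:Z <= f n%:Z by apply: f_incr; lia.
have t_lt0 : t + 1 <= 0 by rewrite leNgt; apply/negP => t0; nia.
have : (t + 1) * n%:Z <= 0 by nia.
by lia.
Qed.

Lemma window_increasing_ge1 (x : int) : 1 <= x -> f 1 <= f x.
Proof.
have [i [t [i_window ->]]] := exists_window_shift x n_gt0 => x_ge1.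
rewrite fD.
have : f 1 <= f i%:Z by apply: (f_incr (i := 1)); lia.
have t_ge0 : 0 <= t by rewrite leNgt; apply/negP => t0; nia.
have : 0 <= t * n%:Z by nia.
by lia.
Qed.

End WindowIncreasing.

Lemma exists_split_quotients (n m u v : nat) : (0 < n)%N ->
  (m.+1 * n <= u + v)%N ->
  exists k l : nat, [/\ (k + l)%N = m, (k * n <= u)%N & (l * n <= v)%N].
Proof.
move=> n_gt0; rewrite (divn_eq u n); have := ltn_pmod u n_gt0.
move: (u %/ n)%N (u %% n)%N => q r r_lt uv_ge.
case: (leqP m q) => q_m; first by exists m, 0%N; split; nia.
by exists q, (m - q)%N; split; nia.
Qed.

(* If f n - f 1 >= (m + 1) n, any intermediate index will do. Otherwise the
   index i with f i = f 1 + 1 mod n differs from 1, and also from n, as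
   m n + 1 < f n - f 1. *)
Lemma exists_intermediate_index (n m : nat) (f : int -> int) : (3 <= n)%N ->
  affine_permutation n f -> window_increasing n f ->
  (m * n).+1%:Z < f n%:Z - f 1 ->
  exists i k l : nat, [/\ (1 < i < n)%N, (k + l)%N = m,
    k%:Z * n%:Z <= f i%:Z - f 1 & l%:Z * n%:Z <= f n%:Z - f i%:Z].
Proof.
move=> n_ge3 [fD [g gK fK]] f_incr gap_gt; have n_gt0 : (0 < n)%N by lia.
case: (leP ((m.+1 * n)%N%:Z) (f n%:Z - f 1)) => gap_ge.
  have f12 : f 1 <= f 2%N%:Z by apply: (f_incr 1%N); lia.
  have f2n : f 2%N%:Z <= f n%:Z by apply: f_incr; lia.
  have [|k [l [klm k_le l_le]]] := @exists_split_quotients n m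
    `|(f 2%N%:Z - f 1)%R|%N `|(f n%:Z - f 2%N%:Z)%R|%N n_gt0; first by lia.
  by exists 2%N, k, l; split=> //; lia.
have [i [t [i_window /(congr1 f)]]] := exists_window_shift (g (f 1 + 1)) n_gt0.
rewrite fK fD => fi.
have f1i : f 1 <= f i%:Z by apply: (f_incr 1%N); lia.
have fin : f i%:Z <= f n%:Z by apply: f_incr; lia.
have t_le0 : t <= 0 by rewrite leNgt; apply/negP => t_gt0; nia.
have [k tk] : exists k : nat, t = - k%:Z.
  by exists `|t|%N; rewrite lez0_abs // opprK.
rewrite tk in fi.
have km : (k <= m)%N by rewrite leqNgt; apply/negP => mk; nia.
have i_neq1 : i <> 1%N.
  move=> i1; have : 1 = - k%:Z * n%:Z by apply: (addrI (f 1)); rewrite fi i1.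
  by nia.
have i_neqn : i <> n by move=> i_n; rewrite i_n in fi; nia.
exists i, k, (m - k)%N; split; [lia|lia|lia|].
by rewrite -subzn //; lia.
Qed.

(** * The action of words on the integers *)

Definition aff_gen (n r : nat) (x : int) : int :=
  if (n%:Z %| x - r%:Z)%Z then x + 1
  else if (n%:Z %| x - r%:Z - 1)%Z then x - 1 else x.

Definition aff_act (n : nat) (w : seq 'I_n) (x : int) : int :=
  foldr (fun i : 'I_n => aff_gen n i) x w.

Lemma aff_gen_quasiperiodic (n r : nat) : quasiperiodic n (aff_gen n r).
Proof.
move=> x t; rewrite /aff_gen.
have dvdD (y : int) : (n%:Z %| y + t * n%:Z)%Z = (n%:Z %| y)%Z.
  by rewrite rpredDr // dvdz_mull.
have -> : x + t * n%:Z - r%:Z = x - r%:Z + t * n%:Z by ring.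
have -> : x - r%:Z + t * n%:Z - 1 = x - r%:Z - 1 + t * n%:Z by ring.
by rewrite !dvdD; case: ifP => _; [|case: ifP => _]; ring.
Qed.

Lemma aff_gen_succ (n r : nat) (x : int) : (2 <= n)%N ->
  (n%:Z %| x - r%:Z)%Z -> aff_gen n r (x + 1) = x.
Proof.
move=> n_ge2 dvd_x; rewrite /aff_gen.
have -> : x + 1 - r%:Z = x - r%:Z + 1 by ring.
rewrite rpredDl // dvdz1 (_ : (_ == _) = false); last by lia.
by rewrite addrK dvd_x addrK.
Qed.

Lemma aff_genK (n r : nat) : (2 <= n)%N -> involutive (aff_gen n r).
Proof.
move=> n_ge2 x; rewrite {2}/aff_gen.
case: ifP => [|dvd_x]; first exact: aff_gen_succ.
case: ifP => dvd_x1; last by rewrite /aff_gen dvd_x dvd_x1.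
have -> : x - 1 = x - r%:Z - 1 + r%:Z by ring.
by rewrite /aff_gen addrK dvd_x1; ring.
Qed.

Lemma aff_act_quasiperiodic (n : nat) (w : seq 'I_n) :
  quasiperiodic n (aff_act w).
Proof. by move=> x t; elim: w => //= i w ->; exact: aff_gen_quasiperiodic. Qed.

Lemma aff_act_cat (n : nat) (u w : seq 'I_n) (x : int) :
  aff_act (u ++ w) x = aff_act u (aff_act w x).
Proof. exact: foldr_cat. Qed.

Lemma aff_actK (n : nat) (w : seq 'I_n) :
  (2 <= n)%N -> cancel (aff_act w) (aff_act (rev w)).
Proof.
move=> n_ge2; elim: w => //= i w IHw x.
by rewrite rev_cons -cats1 aff_act_cat /= aff_genK // IHw.
Qed.

Lemma aff_actVK (n : nat) (w : seq 'I_n) :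
  (2 <= n)%N -> cancel (aff_act (rev w)) (aff_act w).
Proof. by move=> n_ge2 x; rewrite -{1}(revK w) aff_actK. Qed.

Lemma aff_act_affine_permutation (n : nat) (w : seq 'I_n) :
  (2 <= n)%N -> affine_permutation n (aff_act w).
Proof.
move=> n_ge2; split; first exact: aff_act_quasiperiodic.
by exists (aff_act (rev w)); [exact: aff_actK|exact: aff_actVK].
Qed.

(** * Beta-sets of partitions *)

Lemma is_partitionP (la : seq nat) :
  reflect ((forall i, nth 0 la i.+1 <= nth 0 la i)%N /\
           (forall i, i < size la -> 0 < nth 0 la i)%N)
          (is_partition la).
Proof.
apply: (iffP andP) => -[].
  move=> /(sortedP 0%N) la_anti /(all_nthP 0%N) la_pos; split=> // i.
  case: (ltnP i.+1 (size la)) => i_size; first exact: la_anti.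
  by rewrite nth_default.
move=> la_anti la_pos; split; last exact/(all_nthP 0%N).
by apply/(sortedP 0%N) => i _; exact: la_anti.
Qed.

Lemma partition_nth_anti (la : seq nat) (i j : nat) :
  is_partition la -> (i <= j)%N -> (nth 0 la j <= nth 0 la i)%N.
Proof.
move=> /is_partitionP[anti _] /subnK <-.
by elim: (j - i)%N => // k; apply: leq_trans; exact: anti.
Qed.

Lemma partition_gt0 (la : seq nat) (i : nat) :
  is_partition la -> (0 < nth 0 la i)%N = (i < size la)%N.
Proof.
move=> /is_partitionP[_ la_pos].
case: (ltnP i (size la)) => i_size; first exact: la_pos.
by rewrite nth_default.
Qed.

Definition row_bead (la : seq nat) (i : nat) : int := (nth 0%N la i)%:Z - i%:Z.

(* Normalised so that the empty partition gives the nonpositive integers. *)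
Definition beta_set (la : seq nat) : set int := range (row_bead la).

Lemma beta_set_row (la : seq nat) (i : nat) : beta_set la (row_bead la i).
Proof. by exists i. Qed.

Lemma row_bead_ltr (la : seq nat) (i j : nat) : is_partition la ->
  (row_bead la j < row_bead la i) = (i < j)%N.
Proof.
move=> la_part; rewrite /row_bead; case: (ltnP i j) => ij.
  by have := partition_nth_anti la_part (ltnW ij); lia.
by have := partition_nth_anti la_part ij; lia.
Qed.

Lemma beta_set_le_opp_size (la : seq nat) (x : int) :
  x <= - (size la)%:Z -> beta_set la x.
Proof.
by move=> x_le; exists `|x|%N => //; rewrite /row_bead nth_default; lia.
Qed.

Lemma beta_set_le_head (la : seq nat) (x : int) :
  is_partition la -> beta_set la x -> x <= (nth 0%N la 0)%:Z.
Proof.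
move=> la_part [i _ <-]; rewrite /row_bead.
by have := partition_nth_anti la_part (leq0n i); lia.
Qed.

Lemma beta_set_gap_size (la : seq nat) :
  is_partition la -> ~ beta_set la (1 - (size la)%:Z).
Proof.
move=> la_part [i _]; rewrite /row_bead.
by have := partition_gt0 i la_part; lia.
Qed.

Lemma beta_set_gap_above (la : seq nat) (i : nat) : is_partition la ->
  ~ beta_set la (row_bead la i + 1) <->
  (i == 0 \/ nth 0 la i < nth 0 la i.-1)%N.
Proof.
move=> la_part; split=> [gap|addable_row [k _ k_row]].
  case: i gap => [|i] gap; first by left.
  right=> /=; rewrite ltnNge; apply/negP => le_rows; apply: gap; exists i => //.
  by have := partition_nth_anti la_part (leqnSn i); rewrite /row_bead; lia.
have ki : (k < i)%N by rewrite -(row_bead_ltr _ _ la_part) k_row; lia.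
have := @partition_nth_anti la k i.-1 la_part.
by move: k_row; rewrite /row_bead; lia.
Qed.

Lemma beta_set_gap_below (la : seq nat) (i : nat) : is_partition la ->
  ~ beta_set la (row_bead la i - 1) <-> (nth 0 la i.+1 < nth 0 la i)%N.
Proof.
move=> la_part; split=> [gap|removable_row [k _ k_row]].
  rewrite ltnNge; apply/negP => le_rows; apply: gap; exists i.+1 => //.
  by have := partition_nth_anti la_part (leqnSn i); rewrite /row_bead; lia.
have ik : (i < k)%N by rewrite -(row_bead_ltr _ _ la_part) k_row; lia.
have := @partition_nth_anti la i.+1 k la_part.
by move: k_row; rewrite /row_bead; lia.
Qed.

Lemma is_partition_incr_nth (la : seq nat) (i : nat) : is_partition la ->
  is_partition (incr_nth la i) <-> (i == 0 \/ nth 0 la i < nth 0 la i.-1)%N.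
Proof.
move=> la_part; have [la_anti la_pos] := is_partitionP _ la_part; split.
  move/is_partitionP => [mu_anti _]; case: i mu_anti => [|i] mu_anti.
    by left.
  by right; have := mu_anti i; rewrite !nth_incr_nth /=; lia.
move=> addable_row; apply/is_partitionP.
split=> j; rewrite ?size_incr_nth !nth_incr_nth.
  by have := la_anti j; case: (eqVneq i j.+1) addable_row => [->|_] /= ?; lia.
case: (ltnP i (size la)) => i_size j_size.
  by have := la_pos j j_size; lia.
case: eqP => //= i_neq_j.
by have := @partition_nth_anti la j i.-1 la_part; lia.
Qed.

Lemma sorted_geq_decr_nth (la : seq nat) (i : nat) :
  is_partition la -> (i < size la)%N ->
  sorted geq (set_nth 0%N la i (nth 0%N la i).-1) <->
  (nth 0 la i.+1 < nth 0 la i)%N.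
Proof.
move=> la_part i_size; have [la_anti _] := is_partitionP _ la_part; split.
- move/(sortedP 0%N) => /(_ i); rewrite size_set_nth !nth_set_nth /= eqxx.
  rewrite (_ : i.+1 == i = false); last by lia.
  have := partition_gt0 i.+1 la_part; have := partition_gt0 i la_part.
  by have := la_anti i; lia.
- move=> removable_row; apply/(sortedP 0%N) => j _; rewrite !nth_set_nth /=.
  by have := la_anti j; case: (eqVneq j i) removable_row => [->|_] ?;
    case: eqP => ji; rewrite /geq /= ?ji; lia.
Qed.

Lemma addableP (n r : nat) (la : seq nat) (i : nat) : is_partition la ->
  reflect (~ beta_set la (row_bead la i + 1) /\
           (n%:Z %| row_bead la i - r%:Z)%Z)
          (addable n r la i).
Proof.
move=> la_part; rewrite /addable /has_residue eqz_mod_dvd.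
by apply: (iffP andP) => -[gap ?]; split=> //; move: gap;
  rewrite beta_set_gap_above // -is_partition_incr_nth.
Qed.

Lemma removableP (n r : nat) (la : seq nat) (i : nat) : is_partition la ->
  reflect (~ beta_set la (row_bead la i - 1) /\
           (n%:Z %| row_bead la i - r%:Z - 1)%Z)
          (removable n r la i).
Proof.
move=> la_part; rewrite /removable /has_residue eqz_mod_dvd.
have row_pred : (0 < nth 0 la i)%N ->
    (nth 0%N la i).-1%:Z - i%:Z - r%:Z = row_bead la i - r%:Z - 1.
  by rewrite /row_bead; lia.
apply: (iffP and3P) => -[].
  move=> i_size /(sorted_geq_decr_nth la_part i_size) gap dvd.
  by rewrite beta_set_gap_below // -row_pred // partition_gt0.
rewrite beta_set_gap_below // => gap dvd.
have row_gt0 : (0 < nth 0 la i)%N by lia.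
have i_size : (i < size la)%N by rewrite -partition_gt0.
by split=> //; [exact/(sorted_geq_decr_nth la_part i_size)|rewrite row_pred].
Qed.

(* Zero rows of an antitone sequence form a tail, so stripping them moves no
   row. *)
Lemma strip0_partition (g : nat -> nat) (N : nat) :
  (forall i, g i.+1 <= g i)%N -> (forall i, N <= i -> g i = 0)%N ->
  is_partition (strip0 [seq g i | i <- iota 0 N]) /\
  forall i, nth 0%N (strip0 [seq g i | i <- iota 0 N]) i = g i.
Proof.
elim: N g => [|N IHN] g anti g0; first by split=> //= i; rewrite nth_nil g0.
have -> : [seq g i | i <- iota 0 N.+1] = g 0%N :: [seq g i.+1 | i <- iota 0 N].
  by rewrite /= -[1%N]addn0 iotaDl -map_comp.
have [tail_part tailE] := IHN _ (fun i => anti i.+1) (fun i => g0 i.+1).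
rewrite /strip0 /=; case: ifP => g_head; last first.
  have gz i : g i = 0%N by elim: i => [|i IHi]; [lia|have := anti i; lia].
  by split=> // i; rewrite tailE !gz.
have consE i : nth 0%N (g 0%N :: strip0 [seq g i.+1 | i <- iota 0 N]) i = g i.
  by case: i => //= i; rewrite tailE.
split=> //; apply/is_partitionP; split=> i; rewrite !consE //.
by case: i => //= i; rewrite ltnS -(partition_gt0 i tail_part) tailE.
Qed.

Definition flush (n : nat) (B : set int) : Prop :=
  forall x, B x -> B (x - n%:Z).

Lemma flush_sub_mul (n : nat) (B : set int) (x : int) (t : nat) :
  flush n B -> B x -> B (x - t%:Z * n%:Z).
Proof.
move=> flB Bx; elim: t => [|t IHt]; first by rewrite mul0r subr0.
have -> : x - t.+1%:Z * n%:Z = x - t%:Z * n%:Z - n%:Z by lia.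
exact: flB.
Qed.

Lemma flush_gap (n : nat) (B : set int) (x y : int) :
  flush n B -> B x -> ~ B y -> (n%:Z %| y - x)%Z -> x < y.
Proof.
move=> flB Bx nBy /dvdzP[t yx]; rewrite ltNge; apply/negP => y_le_x; apply: nBy.
case: (lerP t 0) => t_sgn; last first.
  have n_eq0 : n = 0%N by nia.
  by have -> : y = x by move: yx; rewrite n_eq0; lia.
have -> : y = x - `|t|%N%:Z * n%:Z by rewrite lez0_abs //; lia.
exact: flush_sub_mul.
Qed.

(* By flush_gap, the gap y - 1 would lie above the bead x, and the gap x + 1
   above the bead y. *)
Lemma flush_addable_removable (n r : nat) (B : set int) (x y : int) :
  flush n B -> B x -> ~ B (x + 1) -> (n%:Z %| x - r%:Z)%Z ->
  B y -> ~ B (y - 1) -> ~~ (n%:Z %| y - r%:Z - 1)%Z.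
Proof.
move=> flB Bx gap_x dvd_x By gap_y; apply/negP => dvd_y.
have dvd_yx : (n%:Z %| y - 1 - x)%Z.
  have -> : y - 1 - x = y - r%:Z - 1 - (x - r%:Z) by ring.
  exact: rpredB.
have := flush_gap flB Bx gap_y dvd_yx.
have dvd_xy : (n%:Z %| x + 1 - y)%Z.
  have -> : x + 1 - y = - (y - 1 - x) by ring.
  by rewrite rpredN.
have := flush_gap flB By gap_x dvd_xy.
by lia.
Qed.

Definition beads_moved (s : int -> int) (la mu : seq nat) : Prop :=
  forall i, row_bead mu i = if `[< beta_set la (s (row_bead la i)) >]
    then row_bead la i else s (row_bead la i).

(* Moving each bead x to s x when that position is free is a bijection onto the
   s-image of the beads, as beads x with s x occupied are permuted by s. *)
Lemma beta_set_moved (s : int -> int) (la mu : seq nat) :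
  involutive s -> beads_moved s la mu ->
  forall x, beta_set mu x <-> beta_set la (s x).
Proof.
move=> sK mu_row x; split=> [[i _ <-]|[i _ si]].
  rewrite mu_row; case: asboolP => // _.
  by rewrite sK; exact: beta_set_row.
case: (pselect (beta_set la x)) => [[j _ jx]|nx].
  exists j => //; rewrite mu_row jx -si asboolT //; exact: beta_set_row.
by exists i => //; rewrite mu_row si sK asboolF.
Qed.

Section CoreGenAct.
Variables (n : nat) (r : 'I_n) (la : seq nat).
Hypotheses (n_ge2 : (2 <= n)%N) (la_part : is_partition la).

Let s := aff_gen n r.

Lemma addable_aff_gen (i : nat) : addable n r la i ->
  s (row_bead la i) = row_bead la i + 1 /\ ~ beta_set la (s (row_bead la i)).
Proof.
by move=> /(addableP _ _ _ la_part)[gap dvd]; rewrite /s /aff_gen dvd.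
Qed.

Lemma removable_aff_gen (i : nat) : removable n r la i ->
  s (row_bead la i) = row_bead la i - 1 /\ ~ beta_set la (s (row_bead la i)).
Proof.
move=> /(removableP _ _ _ la_part)[gap dvd].
have -> : s (row_bead la i) = row_bead la i - 1; last by [].
rewrite -[row_bead la i in LHS](subrK 1); apply: aff_gen_succ => //.
by rewrite addrAC.
Qed.

Lemma unmovable_aff_gen (i : nat) : ~~ addable n r la i ->
  ~~ removable n r la i -> beta_set la (s (row_bead la i)).
Proof.
move=> not_add not_rem; apply: contrapT; rewrite /s /aff_gen.
case: ifP => [dvd|_] gap; first by case/negP: not_add; exact/addableP.
move: gap; case: ifP => [dvd|_] gap.
  by case/negP: not_rem; exact/removableP.
by apply: gap; exact: beta_set_row.
Qed.

Lemma core_gen_act_add :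
  has (addable n r la) (iota 0 (size la).+1) ->
  (forall i, ~~ removable n r la i) ->
  is_partition (core_gen_act r la) /\ beads_moved s la (core_gen_act r la).
Proof.
move=> has_add no_rem; rewrite /core_gen_act has_add.
have [la_anti _] := is_partitionP _ la_part.
have [|i i_gt|mu_part mu_nth] := @strip0_partition
    (fun i => nth 0 la i + addable n r la i)%N (size la).+1.
- move=> i; have := la_anti i; case: (addableP n r i.+1 la_part) => /= [|_].
    by move=> [/(beta_set_gap_above _ la_part)] /=; lia.
  by lia.
- rewrite nth_default ?(ltnW i_gt) //; case: (addableP n r i la_part) => //.
  by move=> [/(beta_set_gap_above _ la_part)]; rewrite !nth_default; lia.
split=> // i; rewrite {1}/row_bead mu_nth.
case: (boolP (addable n r la i)) => [/addable_aff_gen[-> gap]|not_add].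
  by rewrite asboolF // /row_bead; lia.
by rewrite asboolT ?addn0 //; exact: unmovable_aff_gen.
Qed.

Lemma core_gen_act_remove :
  ~~ has (addable n r la) (iota 0 (size la).+1) ->
  is_partition (core_gen_act r la) /\ beads_moved s la (core_gen_act r la).
Proof.
move=> no_add; rewrite /core_gen_act (negbTE no_add).
have not_add i : ~~ addable n r la i.
  apply: contra no_add => add_i; apply/hasP; exists i => //.
  move/(addableP _ _ _ la_part): add_i => [].
  move=> /(beta_set_gap_above _ la_part) gap _.
  by rewrite mem_iota; have := partition_gt0 i.-1 la_part; lia.
have rem_gt i : removable n r la i -> (nth 0 la i.+1 < nth 0 la i)%N.
  by move=> /(removableP _ _ _ la_part)[/(beta_set_gap_below _ la_part)].
have [la_anti _] := is_partitionP _ la_part.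
have [i|i i_ge|mu_part mu_nth] := @strip0_partition
    (fun i => nth 0 la i - removable n r la i)%N (size la).
- have := la_anti i; case: (boolP (removable n r la i)) => [/rem_gt|_] /=; lia.
- by rewrite nth_default.
split=> // i; rewrite {1}/row_bead mu_nth.
case: (boolP (removable n r la i)) => [rem_i|not_rem].
  have [-> gap] := removable_aff_gen rem_i; have := rem_gt i rem_i.
  by rewrite asboolF // /row_bead; lia.
by rewrite asboolT ?subn0 //; exact: unmovable_aff_gen.
Qed.

Lemma core_gen_act_beta_set : flush n (beta_set la) ->
  is_partition (core_gen_act r la) /\
  forall x, beta_set (core_gen_act r la) x <-> beta_set la (s x).
Proof.
move=> flush_la; suff [mu_part moved] : is_partition (core_gen_act r la) /\
    beads_moved s la (core_gen_act r la).
  by split=> //; apply: beta_set_moved moved; exact: aff_genK.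
case: (boolP (has (addable n r la) (iota 0 (size la).+1))); last first.
  exact: core_gen_act_remove.
move=> has_add; apply: core_gen_act_add => // j.
move: has_add => /hasP[i _ /(addableP _ _ _ la_part)[gap_i dvd_i]].
apply/negP => /(removableP _ _ _ la_part)[gap_j]; apply/negP.
exact: (flush_addable_removable flush_la (beta_set_row la i) gap_i dvd_i
  (beta_set_row la j)).
Qed.

End CoreGenAct.

Lemma core_act_beta_set (n : nat) (w : seq 'I_n) : (2 <= n)%N ->
  is_partition (core_act w [::]) /\
  forall x, beta_set (core_act w [::]) x <-> aff_act (rev w) x <= 0.
Proof.
move=> n_ge2; elim: w => [|r w [la_part laE]].
  split=> //= x; split=> [[i _ <-]|]; first by rewrite /row_bead nth_nil; lia.
  by move=> x_le0; apply: beta_set_le_opp_size; rewrite oppr0.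
have [|mu_part muE] := @core_gen_act_beta_set n r _ n_ge2 la_part.
  move=> x /laE x_le; apply/laE.
  by rewrite -mulN1r aff_act_quasiperiodic; lia.
by split=> // x; rewrite rev_cons -cats1 aff_act_cat muE.
Qed.

Lemma hook_length_corner (la : seq nat) : is_partition la ->
  hook_length la 0 0 = (nth 0 la 0 + size la).-1%N.
Proof.
move=> la_part; rewrite /hook_length /in_diagram partition_gt0 // /arm /leg.
case: ifP => la_size; last by case: la la_size {la_part}.
have -> : count (fun p => 0 < p)%N la = size la.
  by apply/eqP; rewrite -all_count; case/andP: la_part.
by have := partition_gt0 0%N la_part; lia.
Qed.

(* aff_act w n - n is the largest bead and aff_act w 1 the smallest gap. The
   difference is -1 for the empty partition, whose corner hook is 0. *)
Lemma core_hook_length_corner (n : nat) (w : seq 'I_n) : (2 <= n)%N ->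
  window_increasing n (aff_act w) ->
  (hook_length (core_act w [::]) 0 0)%:Z =
  Num.max 0 (aff_act w n%:Z - n%:Z - aff_act w 1).
Proof.
move=> n_ge2 w_incr; have [] := core_act_beta_set w n_ge2.
set la := core_act w [::] => la_part laE.
have w_quasi := aff_act_quasiperiodic w; have n_gt0 : (0 < n)%N by lia.
have head : (nth 0%N la 0)%:Z = aff_act w n%:Z - n%:Z.
  rewrite -quasiperiodic0 //; apply/eqP; rewrite eq_le; apply/andP; split.
    have /laE := beta_set_row la 0; rewrite /row_bead subr0.
    by move/(window_increasing_le0 n_gt0 w_quasi w_incr); rewrite aff_actVK.
  by apply: beta_set_le_head => //; apply/laE; rewrite aff_actK.
have first_gap : 1 - (size la)%:Z = aff_act w 1.
  apply/eqP; rewrite eq_le; apply/andP; split.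
    rewrite leNgt; apply/negP => w1_lt.
    have /laE : beta_set la (aff_act w 1) by apply: beta_set_le_opp_size; lia.
    by rewrite aff_actK.
  have /laE/negP := beta_set_gap_size la_part; rewrite -ltNge gtz0_ge1.
  by move/(window_increasing_ge1 n_gt0 w_quasi w_incr); rewrite aff_actVK.
by rewrite hook_length_corner // -head -first_gap; lia.
Qed.

Lemma core_hook_length_eq (n m : nat) (w : seq 'I_n) :
  (2 <= n)%N -> (1 <= m)%N ->
  window_increasing n (aff_act w) ->
  hook_length (core_act w [::]) 0 0 = (n * (m - 1) + 1)%N <->
  aff_act w n%:Z - aff_act w 1 = (m * n).+1%:Z.
Proof.
move=> n_ge2 m_gt0 /(core_hook_length_corner n_ge2) hookE; split; nia.
Qed.

(** * Regions of arrangements of hyperplanes *)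

Section Dot.
Variables (R : realType) (n : nat).
Implicit Types u v a : 'rV[R]_n.

Lemma dotE u a : dot u a = (u *m a^T) ord0 ord0.
Proof. by rewrite mxE; apply: eq_bigr => i _; rewrite mxE. Qed.

Lemma dotC u a : dot u a = dot a u.
Proof. by apply: eq_bigr => i _; rewrite mulrC. Qed.

Lemma dotDl u v a : dot (u + v) a = dot u a + dot v a.
Proof. by rewrite !dotE mulmxDl mxE. Qed.

Lemma dotZl (c : R) v a : dot (c *: v) a = c * dot v a.
Proof. by rewrite !dotE -scalemxAl mxE. Qed.

Lemma dotBl u v a : dot (u - v) a = dot u a - dot v a.
Proof. by rewrite !dotE mulmxBl !mxE. Qed.

Lemma dot_suml (I : finType) (u : I -> 'rV[R]_n) a :
  dot (\sum_i u i) a = \sum_i dot (u i) a.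
Proof. by rewrite dotE mulmx_suml summxE; under eq_bigr do rewrite -dotE. Qed.

Lemma dot_continuous a : continuous (fun v => dot v a).
Proof.
apply: continuous_big => [|i _]; first exact: add_continuous.
move=> v; apply: (@cvgMr_tmp R _ (nbhs v)).
exact: (@coord_continuous R 1 n ord0 i v).
Qed.

Lemma VE : @V R n = [set v | dot v (const_mx 1) = 0].
Proof.
by apply/eq_set => v; rewrite /dot; under [in RHS]eq_bigr do rewrite mxE mulr1.
Qed.

Lemma dot_line u v a (t : R) :
  dot (u + t *: (v - u)) a = (1 - t) * dot u a + t * dot v a.
Proof. by rewrite dotDl dotZl dotBl; ring. Qed.

Lemma V_line u v (t : R) : V u -> V v -> V (u + t *: (v - u)).
Proof. by rewrite VE /= dot_line => -> ->; ring. Qed.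

End Dot.

Section AffineHull.
Variables (R : realType) (n : nat).
Implicit Types (u v a : 'rV[R]_n) (X : set 'rV[R]_n).

Lemma affine_hull_line X u v (t : R) :
  X u -> X v -> affine_hull X (u + t *: (v - u)).
Proof.
move=> Xu Xv; exists 2%N, (fun i => if i == ord0 then u else v),
  (fun i => if i == ord0 then 1 - t else t); split.
- by move=> i; case: ifP.
- by rewrite !big_ord_recl big_ord0 /=; ring.
- rewrite !big_ord_recl big_ord0 /=.
  by apply/rowP => j; rewrite !mxE; ring.
Qed.

Lemma affine_hull_hyperplane X a (k : int) :
  X `<=` hyperplane a k -> affine_hull X `<=` hyperplane a k.
Proof.
move=> Xak v [N [p [c [Xp c1 ->]]]].
have [pV pk] : (forall i, V (p i)) /\ (forall i, dot (p i) a = k%:~R).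
  by split=> i; case: (Xak _ (Xp i)).
split; last first.
  rewrite dot_suml; under eq_bigr do rewrite dotZl pk.
  by rewrite -mulr_suml c1 mul1r.
rewrite VE /= dot_suml big1 // => i _; have := pV i.
by rewrite dotZl VE /= => ->; rewrite mulr0.
Qed.

End AffineHull.

Lemma filter_finite_forall (T : Type) (I : choiceType) (S : set I)
    (F : set_system T) {FF : Filter F} (P : I -> set T) : finite_set S ->
  (forall i, S i -> F (P i)) -> \forall t \near F, forall i, S i -> P i t.
Proof.
move=> /finite_fsetP[D ->] FP.
by apply: filterS (filter_bigI FF FP) => t Pt i Di; exact: Pt.
Qed.

Section Region.
Variables (R : realType) (n : nat).
Implicit Types (u v p q : 'rV[R]_n) (H : 'rV[R]_n * int).

(* The pair H = (a, k) stands for the hyperplane H_{a,k}. *)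
Definition level H v : R := dot v H.1 - H.2%:~R.

Definition same_side H u v : bool := 0 < level H u * level H v.

Definition arrangement (S : set ('rV[R]_n * int)) : set (set 'rV[R]_n) :=
  [set hyperplane H.1 H.2 | H in S].

Lemma level_line H u v (t : R) :
  level H (u + t *: (v - u)) = (1 - t) * level H u + t * level H v.
Proof. by rewrite /level dot_line; ring. Qed.

Lemma same_side_line H u v (t : R) : same_side H u v ->
  0 <= t -> t <= 1 -> same_side H u (u + t *: (v - u)).
Proof.
rewrite /same_side level_line => uv t_ge0 t_le1.
have uu : 0 < level H u * level H u.
  rewrite -expr2 exprn_even_gt0 //=.
  by apply: contraTneq uv => ->; rewrite mul0r ltxx.
have -> : level H u * ((1 - t) * level H u + t * level H v) =
  (1 - t) * (level H u * level H u) + t * (level H u * level H v) by ring.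
by case: (ltP t 1) => t1; nra.
Qed.

Lemma level_continuous H : continuous (level H).
Proof. by move=> v; exact: (cvgB (@dot_continuous R n H.1 v) (cvg_cst _)). Qed.

Lemma line_continuous u v : continuous (fun t : R => u + t *: (v - u)).
Proof.
move=> t; apply: cvgD; first exact: cvg_cst.
by apply: cvgZr_tmp; exact: cvg_id.
Qed.

Lemma same_side_near_line (S : set ('rV[R]_n * int)) p q v :
  finite_set S -> (forall H, S H -> same_side H p q) ->
  exists2 t : R, 0 < t & forall H, S H -> same_side H p (q + t *: (v - q)).
Proof.
move=> S_finite q_side.
have near_q H : S H ->
    \forall t \near (0 : R)^'+, same_side H p (q + t *: (v - q)).
  move=> SH; apply: (cvgr_gt (level H p * level H q)); last exact: q_side.
  have -> : level H q = level H (q + 0 *: (v - q)) by rewrite scale0r addr0.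
  apply: cvg_at_right_filter; apply: cvgMl_tmp.
  apply: (continuous_comp (f := fun t : R => q + t *: (v - q))).
    exact: line_continuous.
  exact: level_continuous.
have [t [t_side t_gt0]] := filter_ex
  (filterI (filter_finite_forall S_finite near_q) (nbhs_right_gt 0)).
by exists t.
Qed.

Variables (S : set ('rV[R]_n * int)) (Reg : set 'rV[R]_n).
Hypothesis Reg_region : components (complement (arrangement S)) Reg.

Lemma region_V v : Reg v -> V v.
Proof. by case: Reg_region => x _ -> /connected_component_sub[]. Qed.

Lemma region_level_neq0 H v : S H -> Reg v -> level H v != 0.
Proof.
move=> SH Rv; rewrite subr_eq0; apply/eqP => Hv.
have : complement (arrangement S) v.
  by case: Reg_region Rv => x _ -> /connected_component_sub.
case=> Vv; apply; exists (hyperplane H.1 H.2) => //.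
by exists H.
Qed.

Lemma region_same_side H u v : S H -> Reg u -> Reg v -> same_side H u v.
Proof.
move=> SH Ru Rv; rewrite /same_side ltNge; apply/negP => uv_le0.
have Reg_connected : connected Reg.
  by case: Reg_region => x _ ->; exact: component_connected.
have /connected_intervalP level_itv := connected_continuous_connected
  Reg_connected (continuous_subspaceT (A := Reg) (@level_continuous H)).
have : (level H @` Reg) 0.
  case: (leP (level H u) 0) => u0.
    apply: (level_itv (level H u) (level H v)); [by exists u|by exists v|].
    rewrite u0 leNgt; apply/negP => v0.
    by have := region_level_neq0 SH Ru; nra.
  apply: (level_itv (level H v) (level H u)); [by exists v|by exists u|].
  by rewrite (ltW u0) andbT leNgt; apply/negP => v0; nra.
by case=> w Rw Hw; have := region_level_neq0 SH Rw; rewrite Hw eqxx.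
Qed.

Lemma region_mem p v : Reg p -> V v ->
  (forall H, S H -> same_side H p v) -> Reg v.
Proof.
move=> Rp Vv side; have Vp := region_V Rp.
case: Reg_region (Rp) => x _ -> cp; rewrite (same_connected_component cp).
pose f (t : R) : 'rV[R]_n := p + t *: (v - p).
have fp : f 0 = p by rewrite /f scale0r addr0.
have fv : f 1 = v by rewrite /f scale1r addrC subrK.
have f_connected : connected (f @` `[0, 1]).
  apply: connected_continuous_connected; first exact: segment_connected.
  by apply: continuous_subspaceT; exact: line_continuous.
have sub : f @` `[0, 1] `<=` complement (arrangement S).
  move=> _ [t t01 <-]; split; first exact: V_line.
  move=> [_ [H SH <-] [_ /eqP]]; apply/negP.
  rewrite -subr_eq0 -/(level H (f t)).
  move: t01; rewrite /= in_itv /= => /andP[t_ge0 t_le1].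
  have : same_side H p (f t) by exact: same_side_line (side H SH) _ _.
  by apply: contraTneq => level0; rewrite /same_side level0 mulr0 ltxx.
apply: (connected_component_max _ sub f_connected).
  by exists 0; rewrite //= in_itv /= lexx ler01.
by exists 1; rewrite //= in_itv /= lexx ler01.
Qed.

Lemma closure_region_mem p v : Reg p -> V v ->
  (forall H, S H -> 0 <= level H p * level H v) -> closure Reg v.
Proof.
move=> Rp Vv side; have Vp := region_V Rp.
apply: (closed_cvg (F := 0^'+) (u_ := fun t : R => v + t *: (p - v))
  (closure Reg)).
- exact: closed_closure.
- near=> t; have t0 : 0 < t by near: t; exact: nbhs_right_gt.
  have t1 : t <= 1 by near: t; apply: nbhs_right_le; exact: ltr01.
  apply: subset_closure; apply: (region_mem Rp); first exact: V_line.
  move=> H SH; rewrite /same_side level_line; have := side H SH.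
  have : 0 < level H p * level H p.
    by rewrite -expr2 exprn_even_gt0 //= region_level_neq0.
  by nra.
- have -> : nbhs v = nbhs (v + 0 *: (p - v)) by rewrite scale0r addr0.
  by apply: cvg_at_right_filter; exact: line_continuous.
Unshelve. all: by end_near. Qed.

Lemma closure_region_level_ge0 H p : S H -> Reg p -> 0 <= level H p ->
  closure Reg `<=` [set v | 0 <= level H v].
Proof.
move=> SH Rp p_ge0; have H_closed : closed [set v | 0 <= level H v].
  exact: (continuous_closedP _).1 (@level_continuous H) _ (@closed_ge R 0).
rewrite ((closure_id _).1 H_closed); apply: closureS => v Rv /=.
have := region_same_side SH Rp Rv; rewrite /same_side.
by have := region_level_neq0 SH Rp; nra.
Qed.

Lemma region_face_mem (a : 'rV[R]_n) (k : int) p v :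
  Reg p -> hyperplane a k v ->
  (forall H, S H -> H <> (a, k) -> same_side H p v) ->
  (closure Reg `&` hyperplane a k) v.
Proof.
move=> Rp Hv v_side; split=> //; case: Hv => Vv vk.
apply: (closure_region_mem Rp) => // H SH.
case: (pselect (H = (a, k))) => [->|Hak]; last exact/ltW/v_side.
by rewrite /level /= vk subrr mulr0.
Qed.

(* Near q, the face of the region contains every direction of H_{a,k}. *)
Lemma region_supports_facet (a : 'rV[R]_n) (k : int) p q :
  finite_set S -> Reg p -> S (a, k) -> hyperplane a k q ->
  (forall H, S H -> H <> (a, k) -> same_side H p q) ->
  supports_facet Reg a k.
Proof.
move=> S_finite Rp Sak Hq q_side; have p_neq0 := region_level_neq0 Sak Rp.
split.
  have one_side v : Reg v -> 0 < (dot p a - k%:~R) * (dot v a - k%:~R).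
    exact: region_same_side Sak Rp.
  case: (ltP 0 (dot p a - k%:~R)) => p_sgn; [left|right] => v Rv;
    (split; first exact: region_V); have := one_side v Rv; nra.
apply/seteqP; split=> [|y Hy]; first by apply: affine_hull_hyperplane => v [].
pose z (t : R) : 'rV[R]_n := q + t *: (y - q).
have Hz t : hyperplane a k (z t).
  case: Hq Hy => [Vq qk] [Vy yk]; split; first exact: V_line.
  by rewrite dot_line qk yk; ring.
have [||t t_gt0 z_side] := @same_side_near_line (S `\ (a, k)) p q y.
- exact: finite_setD.
- by move=> H [SH Hak]; exact: q_side.
have -> : y = q + t^-1 *: (z t - q).
  rewrite /z [q + t *: _]addrC addrK scalerA mulVf ?gt_eqF // scale1r.
  by rewrite addrC subrK.
apply: affine_hull_line; apply: (region_face_mem Rp) => // H SH Hak.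
exact: z_side.
Qed.

End Region.

Lemma refined_region_sub (R : realType) (n : nat) (S T : set ('rV[R]_n * int))
    (Reg A : set 'rV[R]_n) (v : 'rV[R]_n) : S `<=` T ->
  components (complement (arrangement S)) Reg ->
  components (complement (arrangement T)) A -> Reg v -> A v -> A `<=` Reg.
Proof.
move=> ST [x _ ->] AT xv Av; have A_region := AT; case: AT => y _ Ay.
rewrite (same_connected_component xv); apply: connected_component_max => //.
  rewrite Ay; apply: (subset_trans (@connected_component_sub _ _ _)).
  move=> u [Vu Tu]; split=> // -[_ [H SH <-] Hu]; apply: Tu.
  by exists (hyperplane H.1 H.2) => //; exists H => //; exact: ST.
by rewrite Ay; exact: component_connected.
Qed.

(** * Roots *)

Section Roots.
Variables (R : realType) (n : nat).
Implicit Types (u v x : 'rV[R]_n) (a b : 'I_n).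

(* e_a - e_b for 0-based indices a and b. *)
Definition basis_root a b : 'rV[R]_n := alpha R n a.+1 b.

Lemma basis_rootE a b j : basis_root a b ord0 j = (j == a)%:R - (j == b)%:R.
Proof. by rewrite !mxE !eqSS. Qed.

Lemma dot_basis_root v a b : dot v (basis_root a b) = v ord0 a - v ord0 b.
Proof.
have -> : basis_root a b = delta_mx ord0 a - delta_mx ord0 b.
  by apply/rowP => j; rewrite basis_rootE !mxE.
by rewrite dotE linearB /= !trmx_delta mulmxBr -!colE !mxE.
Qed.

Lemma pos_rootsP x :
  pos_roots x <-> exists a b, (a < b)%N /\ x = basis_root a b.
Proof.
split=> [[i [j [i_ge1 ij jn ->]]]|[a [b [ab ->]]]].
  have i_ord : (i.-1 < n)%N by lia.
  have j_ord : (j < n)%N by lia.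
  exists (Ordinal i_ord), (Ordinal j_ord).
  by split; rewrite /basis_root /= ?prednK //; lia.
by exists a.+1, b; split=> //; have := ltn_ord b; lia.
Qed.

Lemma pos_roots_basis_root a b : (a < b)%N -> pos_roots (basis_root a b).
Proof. by move=> ab; apply/pos_rootsP; exists a, b. Qed.

Lemma V_basis_root a b : V (basis_root a b).
Proof. by rewrite VE /= dotC dot_basis_root !mxE subrr. Qed.

Lemma exists_V_basis_root (c : 'I_n -> R) : (0 < n)%N ->
  exists2 v, V v & forall a b, dot v (basis_root a b) = c a - c b.
Proof.
move=> n_gt0; exists (\row_j (c j - (\sum_i c i) / n%:R)).
  rewrite /V /=; under eq_bigr do rewrite mxE.
  rewrite sumrB sumr_const card_ord -[X in _ - X]mulr_natr divfK ?subrr //.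
  by rewrite pnatr_eq0 -lt0n.
by move=> a b; rewrite dot_basis_root !mxE; ring.
Qed.

Lemma dominant_chamberP v : dominant_chamber v <->
  V v /\ forall a b, (a <= b)%N -> 0 <= dot v (basis_root a b).
Proof.
split=> -[Vv v_dom]; split=> //; last first.
  move=> i i_range; have a_ord : (i.-1 < n)%N by lia.
  have b_ord : (i < n)%N by lia.
  have := v_dom (Ordinal a_ord) (Ordinal b_ord).
  by rewrite /basis_root /= prednK; [apply; rewrite leq_pred|lia].
move=> a b; rewrite dot_basis_root subr_ge0; case: b => b.
elim: b => [|b IHb] b_ord; rewrite leq_eqVlt => /predU1P[/val_inj->|] //.
rewrite ltnS => ab; apply: le_trans (IHb (ltnW b_ord) ab).
by have := v_dom b.+1; rewrite -subr_ge0 -dot_basis_root; apply; lia.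
Qed.

End Roots.

Section HighestRoot.
Variables (R : realType) (n : nat).
Implicit Types (v : 'rV[R]_n.+1) (a b : 'I_n.+1).

Lemma theta_basis_root : theta R n.+1 = basis_root R ord0 ord_max.
Proof. by []. Qed.

Lemma dot_theta_root a b : (a < b)%N ->
  dot (theta R n.+1) (basis_root R a b) = (a == ord0)%:R + (b == ord_max)%:R.
Proof.
move=> ab; rewrite theta_basis_root dot_basis_root !basis_rootE.
have b_neq0 : (b == ord0) = false by apply: contraTF ab => /eqP->.
have a_neq_max : (a == ord_max) = false.
  by apply: contraTF ab => /eqP->; rewrite -leqNgt leq_ord.
by rewrite b_neq0 a_neq_max [false%:R]mulr0n; ring.
Qed.

Lemma dot_root_le_theta v a b : dominant_chamber v ->
  dot v (basis_root R a b) <= dot v (theta R n.+1).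
Proof.
move=> /dominant_chamberP[_ v_dom]; rewrite theta_basis_root.
have := v_dom ord0 a (leq0n a); have := v_dom b ord_max (leq_ord b).
by rewrite !dot_basis_root; lra.
Qed.

Lemma fundamental_alcove_sub v : fundamental_alcove v ->
  dominant_chamber v /\ dot v (theta R n.+1) <= 1.
Proof. by case=> Vv /nbhs_singleton; apply. Qed.

Lemma mem_fundamental_alcove v : V v ->
  (forall a b, (a < b)%N -> 0 < dot v (basis_root R a b)) ->
  dot v (theta R n.+1) < 1 -> fundamental_alcove v.
Proof.
move=> Vv v_pos v_theta; split=> //.
have near_pos (ab : 'I_n.+1 * 'I_n.+1) : (ab.1 < ab.2)%N ->
    \forall u \near v, 0 < dot u (basis_root R ab.1 ab.2).
  by move=> /v_pos; exact: cvgr_gt (@dot_continuous R _ _ v) _.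
have near_theta : \forall u \near v, dot u (theta R n.+1) < 1.
  exact: cvgr_lt (@dot_continuous R _ _ v) _ v_theta.
have v_filter : Filter (nbhs v) by exact: nbhs_filter.
apply: (@filterS _ (nbhs v) v_filter _ _ _
  (filterI (filter_finite_forall finite_finset near_pos) near_theta)).
move=> u [u_pos u_theta] Vu.
split; last exact: ltW; apply/dominant_chamberP; split=> // a b.
rewrite leq_eqVlt => /predU1P[/val_inj ->|ab].
  by rewrite dot_basis_root subrr.
exact/ltW/(u_pos (a, b)).
Qed.

(* A vector of H_{theta,k} can take any value on e_1 - e_c. *)
Lemma hyperplane_theta_Nsub (c : 'I_n.+1) (k l : int) :
  c != ord0 -> c != ord_max ->
  ~ hyperplane (theta R n.+1) k `<=` hyperplane (basis_root R ord0 c) l.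
Proof.
move=> c_neq0 c_neq_max.
have max_neq0 : (@ord_max n == ord0) = false.
  apply: contraNF c_neq0 => /eqP/(congr1 val) /= n_eq0.
  by rewrite -val_eqE /= -leqn0 -[X in (_ <= X)%N]n_eq0 leq_ord.
have [v Vv v_root] := exists_V_basis_root (fun j : 'I_n.+1 =>
  if j == ord0 then k%:~R else if j == c then k%:~R - l%:~R - 1 else 0 : R)
  (ltn0Sn n).
have Hv : hyperplane (theta R n.+1) k v.
  split=> //; rewrite theta_basis_root v_root eqxx max_neq0.
  by rewrite eq_sym (negbTE c_neq_max) subr0.
by move=> /(_ v Hv)[_]; rewrite v_root !eqxx (negbTE c_neq0); lra.
Qed.

End HighestRoot.

Section RootArrangements.
Variables (R : realType) (n : nat).

Definition affine_index : set ('rV[R]_n * int) := [set H | pos_roots H.1].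

Definition shi_index (m : nat) : set ('rV[R]_n * int) :=
  [set H | pos_roots H.1 /\ - m%:Z < H.2 <= m%:Z].

Lemma affine_arrangementE :
  @affine_arrangement R n = arrangement affine_index.
Proof.
apply/seteqP; split=> [_ [a [k [a_root ->]]]|]; first by exists (a, k).
by move=> _ [[a k] a_root <-]; exists a, k.
Qed.

Lemma shi_arrangementE (m : nat) :
  @shi_arrangement R n m = arrangement (shi_index m).
Proof.
apply/seteqP; split=> [_ [a [k [a_root k_range ->]]]|]; first by exists (a, k).
by move=> _ [[a k] [a_root k_range] <-]; exists a, k.
Qed.

Lemma shi_index_sub_affine (m : nat) : shi_index m `<=` affine_index.
Proof. by move=> H []. Qed.

Lemma finite_shi_index (m : nat) : finite_set (shi_index m).
Proof.
pose H (x : 'I_n * 'I_n * 'I_(m.*2)) : 'rV[R]_n * int :=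
  (basis_root R x.1.1 x.1.2, x.2.+1%:Z - m%:Z).
apply: (@sub_finite_set _ _ (range H)); last exact: finite_image.
move=> [x k] [/= /pos_rootsP[a [b [_ ->]]] k_range].
have k_ord : (`|(k + m%:Z)%R|.-1 < m.*2)%N by lia.
by exists (a, b, Ordinal k_ord) => //; rewrite /H /=; congr pair; lia.
Qed.

Lemma shi_index_basis_root (m : nat) (a b : 'I_n) (k : int) : (a < b)%N ->
  - m%:Z < k <= m%:Z -> shi_index m (basis_root R a b, k).
Proof. by split=> //; exact: pos_roots_basis_root. Qed.

End RootArrangements.

(** * Centers of alcoves *)

(* The images of the center of the fundamental alcove, the case f = id. *)
Definition alcove_center (R : realType) (n : nat) (f : int -> int) : 'rV[R]_n :=
  \row_j (n.+1%:R / (2 * n%:R) - (f j.+1%:Z)%:~R / n%:R).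

Lemma ord_predS (n : nat) (i : 'I_n) :
  (ord_pred i).+1 = if i == 0 :> nat then n else i.
Proof.
have ltn_i := ltn_ord i; rewrite /=; case: eqP => [->|i0].
  by rewrite add0n modn_small; lia.
by rewrite (_ : (i + n).-1 = i.-1 + n)%N ?modnDr ?modn_small; lia.
Qed.

Lemma dvdz_ord_sub (n : nat) (i j : 'I_n) : (n%:Z %| j%:Z - i%:Z)%Z = (j == i).
Proof.
by rewrite -eqz_mod_dvd !modz_nat eqz_nat !modn_small.
Qed.

Lemma dvdz_ordS_sub (n : nat) (i j : 'I_n) :
  (n%:Z %| j.+1%:Z - i%:Z)%Z = (j == ord_pred i).
Proof.
have <- := dvdz_ord_sub (ord_pred i) j.
have -> : j.+1%:Z - i%:Z =
  j%:Z - (ord_pred i)%:Z + ((ord_pred i).+1%:Z - i%:Z) by lia.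
rewrite rpredDr // ord_predS.
by case: eqP => [->|_]; rewrite ?subr0 ?dvdzz ?subrr ?dvdz0.
Qed.

Lemma aff_gen_ordS (n : nat) (i j : 'I_n) : (2 <= n)%N ->
  aff_gen n i j.+1%:Z = if j == i then i%:Z else
    if j == ord_pred i then j.+1%:Z + 1 else j.+1%:Z.
Proof.
move=> n_ge2; rewrite /aff_gen dvdz_ordS_sub.
have -> : j.+1%:Z - i%:Z - 1 = j%:Z - i%:Z by lia.
rewrite dvdz_ord_sub; case: (eqVneq j i) => [->|//].
case: eqP => [/(congr1 (S \o val)) /=|_]; last by lia.
by rewrite ord_predS; have := ltn_ord i; case: eqP; lia.
Qed.

Section AlcoveCenter.
Variables (R : realType) (n : nat).
Hypothesis n_ge2 : (2 <= n)%N.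

Let n_neq0 : n%:R != 0 :> R. Proof. by rewrite pnatr_eq0; lia. Qed.

Lemma dot_alcove_center_root (f : int -> int) (a b : 'I_n) :
  dot (alcove_center R n f) (basis_root R a b) =
  (f b.+1%:Z - f a.+1%:Z)%:~R / n%:R.
Proof. by rewrite dot_basis_root !mxE rmorphB /=; ring. Qed.

Lemma gen_act_alcove_center (i : 'I_n) (f : int -> int) : quasiperiodic n f ->
  gen_act i (alcove_center R n f) = alcove_center R n (f \o aff_gen n i).
Proof.
move=> fD; have ltn_i := ltn_ord i; apply/rowP => j.
rewrite [RHS]mxE /= aff_gen_ordS // /gen_act; have := ord_predS i.
case: (eqVneq (i : nat) 0%N) => [i0|_] pred_i.
  rewrite mxE; case: eqVneq => [_|_]; [|case: eqVneq => [->|_]]; rewrite mxE //.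
    by rewrite pred_i i0 (quasiperiodic0 fD) rmorphB /=; field.
  have := fD 1 1; rewrite pred_i i0 mul1r addrC => ->.
  by rewrite rmorphD /=; field.
rewrite !mxE; case: tpermP => [->|->|/eqP/negbTE-> /eqP/negbTE->] //.
  rewrite eqxx pred_i; case: eqVneq => [pred_eq|_].
    by move: pred_i; rewrite pred_eq; lia.
  by rewrite -[i.+1]addn1 PoszD.
by rewrite eqxx pred_i.
Qed.

Lemma word_act_alcove_center (w : seq 'I_n) (f : int -> int) :
  quasiperiodic n f ->
  word_act (rev w) (alcove_center R n f) = alcove_center R n (f \o aff_act w).
Proof.
elim: w f => [|i w IHw] f fD //.
rewrite rev_cons -cats1 /word_act foldr_cat /= gen_act_alcove_center //.
by rewrite -/(word_act _ _) IHw // => x t /=; rewrite aff_gen_quasiperiodic fD.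
Qed.

Lemma V_alcove_center_id : V (alcove_center R n id).
Proof.
rewrite /V /=; under eq_bigr do rewrite mxE.
rewrite sumrB sumr_const card_ord -mulr_suml.
have -> : \sum_(i < n) (i.+1%:Z)%:~R = (n * n.+1)%:R / 2 :> R.
  elim: (n) => [|k IHk]; first by rewrite big_ord0 mul0n mul0r.
  rewrite big_ord_recr /= IHk -[k.+1%:~R]/(k.+1%:R) !natrM -!natr1.
  by field.
by rewrite -mulr_natr natrM; field.
Qed.

Lemma dot_alcove_center_id_root (a b : 'I_n) : (a < b)%N ->
  0 < dot (alcove_center R n id) (basis_root R a b) < 1.
Proof.
move=> ab; have n_gt0 : 0 < n%:R :> R by rewrite ltr0n; lia.
have ltn_b := ltn_ord b; rewrite dot_alcove_center_root.
rewrite divr_gt0 ?ltr_pdivrMr //= ?ltr0z; last by lia.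
by rewrite mul1r pmulrn ltr_int; lia.
Qed.

Lemma dominant_alcove_center (f : int -> int) :
  dominant_chamber (alcove_center R n f) -> window_increasing n f.
Proof.
move=> /dominant_chamberP[_ f_dom] i j /andP[i_ge1 ij] jn.
have i_ord : (i.-1 < n)%N by lia.
have j_ord : (j.-1 < n)%N by lia.
have := f_dom (Ordinal i_ord) (Ordinal j_ord); rewrite dot_alcove_center_root.
rewrite /= !prednK; [|by lia|by lia].
by rewrite pmulr_lge0 ?invr_gt0 ?ltr0n ?ler0z ?subr_ge0; [apply|]; lia.
Qed.

End AlcoveCenter.

Lemma alcove_center_fundamental (R : realType) (n : nat) : (0 < n)%N ->
  fundamental_alcove (alcove_center R n.+1 id).
Proof.
move=> n_gt0; apply: mem_fundamental_alcove; first exact: V_alcove_center_id.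
  by move=> a b /(@dot_alcove_center_id_root R n.+1 n_gt0) /andP[].
by have /andP[] := @dot_alcove_center_id_root R n.+1 n_gt0 ord0 ord_max n_gt0.
Qed.

(** * The wall orthogonal to the highest root *)

Lemma int_mul_shift_gt0 (R : realFieldType) (z : int) (d : R) :
  z != 0 -> 0 <= d -> d < 1 -> 0 < z%:~R * (z%:~R - d).
Proof.
move=> z_neq0 d_ge0 d_lt1; case: (ltP 0 z) => z_sgn.
  have : 1 <= z%:~R :> R by rewrite ler1z; lia.
  by nra.
have : z%:~R <= -1 :> R by rewrite -[-1]/((-1)%:~R) ler_int; lia.
by nra.
Qed.

Section ThetaWall.
Variables (R : realType) (n m : nat) (Reg : set 'rV[R]_n.+1) (f : int -> int).
Hypotheses (n_gt0 : (0 < n)%N) (m_gt0 : (0 < m)%N).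
Hypothesis Reg_shi : shi_region m Reg.
Hypothesis f_perm : affine_permutation n.+1 f.

Let p := alcove_center R n.+1 f.
Let gap := f n.+1%:Z - f 1.
Let th := theta R n.+1.

Hypothesis Rp : Reg p.

Let Reg_region : components (complement (arrangement (shi_index m))) Reg.
Proof. by rewrite -shi_arrangementE. Qed.

Let nR_gt0 : 0 < n.+1%:R :> R. Proof. by rewrite ltr0n. Qed.

Let shi_index_theta : shi_index m (th, m%:Z).
Proof. by apply: (@shi_index_basis_root R n.+1 m ord0 ord_max) => //; lia. Qed.

Lemma level_alcove_center (a b : 'I_n.+1) (k : int) :
  level (basis_root R a b, k) p =
  (f b.+1%:Z - f a.+1%:Z - k * n.+1%:Z)%:~R / n.+1%:R.
Proof.
rewrite /level dot_alcove_center_root [in RHS]rmorphB rmorphM /= -pmulrn mulrBl.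
by rewrite mulfK // gt_eqF.
Qed.

Lemma level_alcove_center_ge0 (a b : 'I_n.+1) (k : int) :
  (0 <= level (basis_root R a b, k) p) = (k * n.+1%:Z <= f b.+1%:Z - f a.+1%:Z).
Proof.
by rewrite level_alcove_center pmulr_lge0 ?invr_gt0 // ler0z subr_ge0.
Qed.

Lemma closure_region_root_ge (a b : 'I_n.+1) (k : nat) :
  (a < b)%N -> (k <= m)%N -> k%:Z * n.+1%:Z <= f b.+1%:Z - f a.+1%:Z ->
  closure Reg `<=` [set v | k%:~R <= dot v (basis_root R a b)].
Proof.
move=> ab km f_ge v cv; rewrite /= -subr_ge0.
apply: (closure_region_level_ge0 (H := (basis_root R a b, k%:Z))
  Reg_region _ Rp).
- by apply: shi_index_basis_root => //; lia.
- by rewrite level_alcove_center_ge0.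
- exact: cv.
Qed.

Lemma dot_alcove_center_theta : dot p th = gap%:~R / n.+1%:R.
Proof. by rewrite /th theta_basis_root dot_alcove_center_root. Qed.

Lemma fundamental_alcove_le_theta :
  @fundamental_alcove R n.+1 `<=` le_halfspace th m%:Z.
Proof.
move=> v /fundamental_alcove_sub[[Vv _] v_theta]; split=> //.
by apply: le_trans v_theta _; rewrite -pmulrn ler1n.
Qed.

(* The orthogonal projection of p to H_{theta,m} when <p, theta> = m + 1/n. *)
Let q := p - (2 * n.+1%:R)^-1 *: th.

Lemma same_side_theta_projection (H : 'rV[R]_n.+1 * int) :
  gap = (m * n.+1).+1%:Z -> shi_index m H -> H <> (th, m%:Z) ->
  same_side H p q.
Proof.
move=> gapE SH H_neq; have p_neq0 := region_level_neq0 Reg_region SH Rp.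
case: H SH H_neq p_neq0 => x k [/= /pos_rootsP[a [b [ab ->]]] k_range].
rewrite /same_side => H_neq p_neq0.
have -> : level (basis_root R a b, k) q = level (basis_root R a b, k) p -
    ((a == ord0)%:R + (b == ord_max)%:R) / 2 / n.+1%:R.
  by rewrite /level dotBl dotZl dot_theta_root // invfM; ring.
move: p_neq0; rewrite level_alcove_center -mulrBl.
set z := f _ - f _ - _ => z_neq0.
have {}z_neq0 : z != 0 by apply: contraNneq z_neq0 => ->; rewrite mul0r.
have z_theta : a = ord0 -> b = ord_max -> 1 < z.
  move=> a0 b_max; have k_neq : k <> m.
    by move=> km; apply: H_neq; rewrite a0 b_max km.
  have : z = gap - k * n.+1%:Z by rewrite /z a0 b_max.
  by rewrite gapE; nia.
rewrite mulrACA; apply: mulr_gt0; last by rewrite mulr_gt0 ?invr_gt0.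
case: (boolP ((a == ord0) && (b == ord_max))) => [ab_eq|ab_neq].
  have [/eqP a0 /eqP b_max] := andP ab_eq.
  have z_gt1 : 1 < z%:~R :> R by rewrite ltr1z; exact: z_theta.
  rewrite a0 b_max !eqxx /=; nra.
apply: int_mul_shift_gt0 => //.
  by rewrite divr_ge0 // addr_ge0.
by move: ab_neq; case: (a == _); case: (b == _) => //= _; lra.
Qed.

Lemma theta_separating_wall :
  gap = (m * n.+1).+1%:Z -> separating_wall m Reg th m%:Z.
Proof.
move=> gapE; have Hq : hyperplane th m%:Z q.
  split.
    move: (region_V Reg_region Rp) (@V_basis_root R n.+1 ord0 ord_max).
    by rewrite VE /= (dotBl p) dotZl => -> ->; rewrite mulr0 subr0.
  rewrite (dotBl p) dotZl (@dot_theta_root R n ord0 ord_max) // !eqxx mulr1n.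
  rewrite dot_alcove_center_theta gapE -!pmulrn -[(m * _).+1%:R]natr1 natrM.
  by move: nR_gt0; move: (n.+1%:R : R) => N N_gt0; field; rewrite gt_eqF.
have facet := region_supports_facet Reg_region (@finite_shi_index R n.+1 m) Rp
  shi_index_theta Hq (fun H => same_side_theta_projection gapE).
split; first by split=> //; rewrite shi_arrangementE; exists (th, m%:Z).
left; split; last exact: fundamental_alcove_le_theta.
move=> v Rv; split; first exact (region_V Reg_region Rv).
apply: (closure_region_root_ge (a := ord0) (b := ord_max)) => //.
  by rewrite /= -/gap gapE; lia.
exact: subset_closure.
Qed.

Lemma separating_wall_gap_gt :
  separating_wall m Reg th m%:Z -> (m * n.+1)%:Z < gap.
Proof.
case=> _ [[Reg_ge _]|[_ A0_ge]].
  have [_ p_ge] := Reg_ge p Rp.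
  have p_neq0 := region_level_neq0 Reg_region shi_index_theta Rp.
  have : 0 < level (th, m%:Z) p by rewrite lt_def p_neq0 subr_ge0.
  rewrite (level_alcove_center ord0 ord_max) pmulr_lgt0 ?invr_gt0 // ltr0z.
  by rewrite subr_gt0 PoszM.
have [_] := A0_ge _ (alcove_center_fundamental R n_gt0).
have /andP[_ c_lt1] :=
  @dot_alcove_center_id_root R n.+1 n_gt0 ord0 ord_max n_gt0.
move=> /(le_lt_trans)/(_ c_lt1); rewrite -pmulrn ltrn1; lia.
Qed.

Lemma face_sub_hyperplane (c : 'I_n.+1) (k l : nat) :
  c != ord0 -> c != ord_max -> (k + l)%N = m ->
  k%:Z * n.+1%:Z <= f c.+1%:Z - f 1 ->
  l%:Z * n.+1%:Z <= f n.+1%:Z - f c.+1%:Z ->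
  closure Reg `&` hyperplane th m%:Z `<=` hyperplane (basis_root R ord0 c) k.
Proof.
move=> c_neq0 c_neq_max klm k_le l_le v [cv [Vv]].
rewrite -klm PoszD rmorphD /th theta_basis_root => v_theta.
have v_low : k%:~R <= dot v (basis_root R ord0 c).
  by apply: closure_region_root_ge cv; rewrite ?lt0n // -klm leq_addr.
have v_high : l%:~R <= dot v (basis_root R c ord_max).
  apply: closure_region_root_ge cv; rewrite // -?klm ?leq_addl //.
  by rewrite ltn_neqAle leq_ord andbT.
by split=> //; move: v_low v_high v_theta; rewrite !dot_basis_root; lra.
Qed.

Lemma separating_wall_gapE : (1 < n)%N -> window_increasing n.+1 f ->
  separating_wall m Reg th m%:Z -> gap = (m * n.+1).+1%:Z.
Proof.
move=> n_gt1 f_incr sep; have gap_gt := separating_wall_gap_gt sep.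
apply/eqP; rewrite eq_le; apply/andP; split; last by lia.
rewrite leNgt; apply/negP => gap_large.
have [|i [k [l [i_range klm k_le l_le]]]] :=
  exists_intermediate_index _ f_perm f_incr gap_large; first by lia.
have c_ord : (i.-1 < n.+1)%N by lia.
pose c := Ordinal c_ord; have cS : c.+1 = i by rewrite /= prednK //; lia.
have c_neq0 : c != ord0 by rewrite -val_eqE /=; lia.
have c_neq_max : c != ord_max by rewrite -val_eqE /=; lia.
rewrite -cS in k_le l_le.
have face := face_sub_hyperplane c_neq0 c_neq_max klm k_le l_le.
apply: (@hyperplane_theta_Nsub R n c m%:Z k%:Z c_neq0 c_neq_max).
by case: sep => [[_ [_ <-]] _]; exact: affine_hull_hyperplane.
Qed.

End ThetaWall.

(** * Separating hyperplanes of a dominant alcove *)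

Lemma in_different_halfspaces_dominant (R : realType) (n : nat)
    (A : set 'rV[R]_n.+1) (p : 'rV[R]_n.+1) (a b : 'I_n.+1) (k : int) :
  (0 < n)%N -> alcove A -> A p -> dominant_chamber p -> (a < b)%N ->
  in_different_halfspaces (basis_root R a b) k A (@fundamental_alcove R n.+1)
  <-> 0 < k /\ k%:~R < dot p (basis_root R a b).
Proof.
move=> n_gt0; rewrite /alcove affine_arrangementE => A_region Ap p_dom ab.
have index_ab : @affine_index R n.+1 (basis_root R a b, k).
  exact: pos_roots_basis_root.
split=> [sep|[k_gt0 pk]].
  have A0c := alcove_center_fundamental R n_gt0.
  have /andP[c_gt0 c_lt1] := @dot_alcove_center_id_root R n.+1 n_gt0 a b ab.
  have [_ /(_ a b (ltnW ab)) p_ge0] := (dominant_chamberP p).1 p_dom.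
  have := region_level_neq0 A_region index_ab Ap.
  rewrite /level /= subr_eq0 => p_neq.
  case: sep => -[/(_ _ Ap)[_ pk] /(_ _ A0c)[_ ck]].
    split; first by rewrite -(ltr_int R) (lt_le_trans c_gt0).
    by rewrite lt_neqAle eq_sym p_neq.
  have k_lt1 : k < 1 by rewrite -(ltr_int R) (le_lt_trans ck).
  have k_ge0 : 0 <= k by rewrite -(ler_int R) (le_trans p_ge0).
  have k_eq0 : k = 0 by lia.
  by case/negP: p_neq; rewrite k_eq0 in pk *; rewrite eq_le pk.
left; split=> v.
  move=> Av; split; first exact (region_V A_region Av).
  have := region_same_side A_region index_ab Ap Av.
  by rewrite /same_side pmulr_rgt0 ?subr_gt0 // => /ltW.
move=> /fundamental_alcove_sub[v_dom v_theta]; split; first by case: v_dom.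
apply: le_trans (dot_root_le_theta a b v_dom) (le_trans v_theta _).
by rewrite ler1z; lia.
Qed.

Section RankOne.
Variable R : realType.

Let th := theta R 2.

Lemma ord2_lt (a b : 'I_2) : (a < b)%N -> a = ord0 /\ b = ord_max.
Proof. by have := ltn_ord b; split; apply/val_inj => /=; lia. Qed.

Lemma pos_roots_rank1 (x : 'rV[R]_2) : pos_roots x <-> x = th.
Proof.
rewrite pos_rootsP; split=> [[a [b [/ord2_lt[-> ->] ->]]]//|->].
by exists ord0, ord_max.
Qed.

Lemma exists_V_dot_theta (x : R) : exists2 v : 'rV[R]_2, V v & dot v th = x.
Proof.
have [v Vv v_root] := @exists_V_basis_root R 2
  (fun j => if j == ord0 then x else 0) isT.
by exists v => //; rewrite /th theta_basis_root v_root subr0.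
Qed.

Lemma hyperplane_theta_inj : injective (@hyperplane R 2 th).
Proof.
move=> k l kl; have [v Vv vk] := exists_V_dot_theta k%:~R.
have [_] : hyperplane th l v by rewrite -kl.
by rewrite vk => /intr_inj.
Qed.

Lemma card_separating_hyperplanes_rank1 (A : set 'rV[R]_2) (p : 'rV[R]_2)
    (N : nat) :
  alcove A -> A p -> N%:R < dot p th < N.+1%:R ->
  (separating_hyperplanes A (@fundamental_alcove R 2) #= `I_N)%card.
Proof.
move=> A_alcove Ap /andP[p_gt p_lt]; have p_dom : dominant_chamber p.
  apply/dominant_chamberP; split.
    by move: A_alcove; rewrite /alcove affine_arrangementE => /region_V; apply.
  move=> a b; rewrite leq_eqVlt => /predU1P[/val_inj ->|/ord2_lt[-> ->]].
    by rewrite dot_basis_root subrr.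
  by rewrite -theta_basis_root; apply: le_trans (ltW p_gt); rewrite ler0n.
have sepE k := in_different_halfspaces_dominant k (ltn0Sn 0) A_alcove Ap p_dom
  (ltn0Sn 0 : (@ord0 1 < @ord_max 1)%N).
have -> : separating_hyperplanes A (@fundamental_alcove R 2) =
    (fun k : nat => hyperplane th k.+1%:Z) @` `I_N.
  apply/seteqP; split=> [_ [x [k [/pos_roots_rank1-> -> /sepE[k_gt0 pk]]]]|].
    exists `|k|%N.-1; last by congr hyperplane; lia.
    have : k < N.+1%:Z by rewrite -(ltr_int R) (lt_trans pk).
    by rewrite /=; lia.
  move=> _ [k /= kN <-]; exists th, k.+1%:Z; split=> //.
    exact/pos_roots_rank1.
  apply/sepE; split=> //.
  by apply: le_lt_trans p_gt; rewrite -pmulrn ler_nat.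
by apply: inj_card_eq => k l _ _ /hyperplane_theta_inj[].
Qed.

Lemma exists_alcove_beyond_theta (m : nat) (Reg : set 'rV[R]_2) (p : 'rV[R]_2) :
  shi_region m Reg -> Reg p -> m%:R < dot p th ->
  exists B b, [/\ alcove B, B `<=` Reg, B b & m%:R < dot b th < m.+1%:R].
Proof.
move=> Reg_shi Rp p_gt; have [b Vb b_th] := exists_V_dot_theta (m%:R + 2^-1).
have Reg_region : components (complement (arrangement (shi_index m))) Reg.
  by rewrite -shi_arrangementE.
have Rb : Reg b.
  apply: (region_mem Reg_region Rp) => // -[x k].
  move=> [/= /pos_roots_rank1-> /andP[_ km]].
  have : k%:~R <= m%:R :> R by rewrite pmulrn ler_int.
  by rewrite /same_side /level /= b_th => k_le; apply: mulr_gt0; lra.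
have b_compl : complement (@affine_arrangement R 2) b.
  split=> // -[_ [x [k [/pos_roots_rank1-> ->]]] [_]]; rewrite -/th b_th => bk.
  have : (m%:Z * 2 + 1)%:~R = (k * 2)%:~R :> R.
    by rewrite rmorphD !rmorphM /= -bk -pmulrn; field.
  by move/intr_inj; lia.
pose B := connected_component (complement (@affine_arrangement R 2)) b.
have B_alcove : alcove B by exists b.
have Bb : B b by exact: connected_component_refl.
exists B, b; split=> //; last by rewrite b_th -[m.+1%:R]natr1; lra.
apply: (refined_region_sub (@shi_index_sub_affine R 2 m) Reg_region _ Rb Bb).
by rewrite -affine_arrangementE.
Qed.

Lemma minimal_alcove_gapE (m : nat) (Reg A : set 'rV[R]_2) (f : int -> int) :
  shi_region m Reg -> minimal_alcove Reg A -> affine_permutation 2 f ->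
  A (alcove_center R 2 f) -> (m * 2)%:Z < f 2%:Z - f 1 ->
  f 2%:Z - f 1 = (m * 2).+1%:Z.
Proof.
move=> Reg_shi [A_alcove A_Reg A_min] f_perm Ap gap_gt.
set p := alcove_center R 2 f in Ap.
have gap_odd : ~~ (2 %| f 2%:Z - f 1)%Z.
  by rewrite (affine_permutation_dvdz (n := 2)).
have [N gapE] : exists N : nat, f 2%:Z - f 1 = (N * 2).+1%:Z.
  move: (f 2%:Z - f 1) gap_gt gap_odd => x x_gt x_odd.
  by exists `|(x %/ 2)%Z|%N; lia.
have p_th : dot p th = N%:R + 2^-1.
  rewrite dot_alcove_center_theta gapE -pmulrn.
  by rewrite -[(N * 2).+1%:R]natr1 natrM; field.
have m_le_N : m%:R <= N%:R :> R by rewrite ler_nat; lia.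
have [|B [b [B_alcove B_Reg Bb b_th]]] :=
    exists_alcove_beyond_theta Reg_shi (A_Reg _ Ap).
  by rewrite -/p p_th; lra.
have card_A : (separating_hyperplanes A (@fundamental_alcove R 2) #= `I_N)%card.
  apply: (card_separating_hyperplanes_rank1 A_alcove Ap).
  by rewrite p_th -[N.+1%:R]natr1; lra.
have card_B := card_separating_hyperplanes_rank1 B_alcove Bb b_th.
have := A_min B B_alcove B_Reg.
by rewrite (card_le_eql card_A) (card_le_eqr card_B) card_le_II; lia.
Qed.

End RankOne.

Theorem theorem3p5 (R : realType) (n m : nat) (hn : (2 <= n)%N) (hm : (1 <= m)%N)
  (Reg A : set 'rV[R]_n) (la : seq nat) :
  shi_region m Reg -> dominant Reg -> minimal_alcove Reg A ->
  is_core n la -> Phi la A ->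
  (separating_wall m Reg (theta R n) m%:Z
   <-> hook_length la 0 0 = (n * (m - 1) + 1)%N).
Proof.
case: n hn Reg A => // n n_gt0 Reg A Reg_shi Reg_dom A_min _ [w [_ -> A_w]].
have w_perm := aff_act_affine_permutation w n_gt0.
have Ap : A (alcove_center R n.+1 (aff_act w)).
  rewrite A_w; exists (alcove_center R n.+1 id).
    exact: alcove_center_fundamental.
  exact: word_act_alcove_center.
have Rp : Reg (alcove_center R n.+1 (aff_act w)) by case: A_min => _ + _; apply.
have w_incr : window_increasing n.+1 (aff_act w).
  by apply: dominant_alcove_center (Reg_dom _ Rp).
rewrite core_hook_length_eq //.
split=> [sep|]; last exact: theta_separating_wall.
case: (ltnP 1 n) => [n_gt1|n_le1]; first exact: separating_wall_gapE sep.
have gap_gt := separating_wall_gap_gt n_gt0 hm Reg_shi Rp sep.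
have n1 : n = 1%N by lia.
by subst n; exact: minimal_alcove_gapE A_min w_perm Ap gap_gt.
Qed.
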